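(* Let $n, k$ be positive integers such that $\lfloor n/2 \rfloor < k \leq n-1$, and let $m \in \{2,3, \ldots, n-1 \}$ be an integer such that $n-\lceil n/m \rceil < k \leq n-\lceil n/(m+1) \rceil$. Then $\{m+1, m+2, \ldots, k+1\} \subseteq \mathrm{Spec}(P_n, k)$.
   Context: $P_n$ is the path on $n$ vertices $v_1,\dots,v_n$ (in order), with graph distance $\mathrm{dist}(v_i,v_j)=|i-j|$; its diameter is $n-1$. For a set $D$ of positive integers, the distance graph $G(P_n,D)$ has vertex set $\{v_1,\dots,v_n\}$, with $v_i,v_j$ ($i\ne j$) adjacent iff $|i-j|\in D$; $\chi(P_n,D)$ is its chromatic number. The Babai $k$-spectrum is $\mathrm{Spec}(P_n,k)=\{\chi(P_n,D): D\subseteq\{1,2,\dots,n-1\},\ |D|=k\}$. *)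

(* Defs.v *)
From mathcomp Require Import all_boot all_order ssralg ssrnum ssrint finmap.

Set Implicit Arguments.
Unset Strict Implicit.
Unset Printing Implicit Defensive.

Import IntDist.

Record sgraph := SGraph {
  vertex : finType;
  adj : rel vertex;
  adj_sym : symmetric adj;
  adj_irrefl : irreflexive adj }.

Definition proper_coloring (G : sgraph) (c : nat)
    (f : {ffun vertex G -> 'I_c}) : bool :=
  [forall x, forall y, @adj G x y ==> (f x != f y)].

Definition colorable (G : sgraph) (c : nat) : bool :=
  [exists f : {ffun vertex G -> 'I_c}, proper_coloring f].

Lemma colorable_card (G : sgraph) : exists c, colorable G c.
Proof.
exists #|vertex G|; apply/existsP; exists [ffun x => enum_rank x].
apply/forallP => x; apply/forallP => y; apply/implyP => exy.
rewrite !ffunE (inj_eq enum_rank_inj).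
by apply: contraTneq exy => ->; rewrite adj_irrefl.
Qed.

Definition chromatic_number (G : sgraph) : nat := ex_minn (colorable_card G).

(* The vertex v_i of P_n, for 1 <= i <= n, is encoded as the ordinal i - 1. *)
Definition path_dist (n : nat) (x y : 'I_n) : nat := `|x - y|%N.

Definition distance_adj (n : nat) (D : {pred nat}) : rel 'I_n :=
  fun x y => (x != y) && (path_dist x y \in D).

Lemma distance_adj_sym (n : nat) (D : {pred nat}) : symmetric (@distance_adj n D).
Proof. by move=> x y; rewrite /distance_adj /path_dist eq_sym distnC. Qed.

Lemma distance_adj_irrefl (n : nat) (D : {pred nat}) :
  irreflexive (@distance_adj n D).
Proof. by move=> x; rewrite /distance_adj eqxx. Qed.

Definition distance_graph (n : nat) (D : {pred nat}) : sgraph :=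
  SGraph (@distance_adj_sym n D) (@distance_adj_irrefl n D).

Definition chi (n : nat) (D : {pred nat}) : nat :=
  chromatic_number (distance_graph n D).

Definition Spec (n k : nat) (c : nat) : Prop :=
  exists D : {fset nat},
    [/\ forall d, d \in D -> 1 <= d <= n.-1, #|` D| = k & c = chi n (mem D)].

Definition ceil_div (a b : nat) : nat := (a + b.-1) %/ b.

Lemma ceil_div_leq (a b c : nat) : 0 < b -> (ceil_div a b <= c) = (a <= c * b).
Proof.
by case: b => // b _; rewrite /ceil_div -ltnS ltn_divLR //= mulSn addSn ltnS addnC leq_add2l.
Qed.

(* Main.v *)
Require Import Defs.
From mathcomp Require Import all_boot.
From mathcomp Require Import ssrint finmap zify.

(**
Choose [D] of size [k] with {1, ..., c-1} contained in [D] and no multiple of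
[c] in [D].  The first [c] vertices then form a clique, and colouring each
vertex by its index modulo [c] is proper, so the chromatic number is [c].
Such a [D] exists because [c - 1 <= k], and because the number of non-multiples
of [c] below [n], namely n - ceil(n/c), is at least n - ceil(n/(m+1)) >= k.
*)

Lemma chromatic_number_eq (G : sgraph) (c : nat) :
  colorable G c -> (forall c', colorable G c' -> c <= c') ->
  chromatic_number G = c.
Proof.
move=> colc minc; rewrite /chromatic_number; case: ex_minnP => c' colc' minc'.
by apply/eqP; rewrite eqn_leq minc' // minc.
Qed.

Lemma colorable_distance_graph_modn (n c : nat) (D : {pred nat}) :
  0 < c -> (forall d, d \in D -> ~~ (c %| d)) ->
  colorable (distance_graph n D) c.
Proof.
move=> c_gt0 Dc; apply/existsP.
exists [ffun x : vertex (distance_graph n D) =>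
  Ordinal (ltn_pmod (nat_of_ord (x : 'I_n)) c_gt0)].
apply/forallP => x; apply/forallP => y; apply/implyP => /andP[_ /Dc].
rewrite !ffunE; apply: contra => /eqP[] /eqP; rewrite /path_dist.
case: (leqP x y) => [lexy|/ltnW leyx].
  by rewrite distnEr // eq_sym eqn_mod_dvd.
by rewrite distnEl // eqn_mod_dvd.
Qed.

(** Any two of the first [c] vertices lie at a distance in {1, ..., c-1}, so a proper colouring is
    injective on them. *)
Lemma colorable_distance_graph_geq (n c c' : nat) (D : {pred nat}) :
  c <= n -> (forall d, 0 < d < c -> d \in D) ->
  colorable (distance_graph n D) c' -> c <= c'.
Proof.
move=> len Dlt /existsP[f /forallP fP].
suff /leq_card : injective (f \o widen_ord len) by rewrite !card_ord.
move=> x y /= fxy; apply/eqP; case: eqVneq => // nexy.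
have /forallP/(_ (widen_ord len y))/implyP := fP (widen_ord len x).
rewrite fxy eqxx; apply; rewrite /= /distance_adj /path_dist.
have nexy' : nat_of_ord x != y by [].
rewrite -val_eqE /= nexy' /=; apply: Dlt.
have := ltn_ord x; have := ltn_ord y; lia.
Qed.

Lemma chi_eq (n c : nat) (D : {pred nat}) :
  0 < c <= n -> (forall d, 0 < d < c -> d \in D) ->
  (forall d, d \in D -> ~~ (c %| d)) -> chi n D = c.
Proof.
move=> /andP[c_gt0 len] Dlt Dc; apply: chromatic_number_eq.
  exact: colorable_distance_graph_modn.
by move=> c'; apply: colorable_distance_graph_geq.
Qed.

Lemma count_dvdn_iota (c N : nat) : 0 < c ->
  count (dvdn c) (iota 1 N) = N %/ c.
Proof.
by move=> c_gt0; rewrite divn_count_dvd -sum1_count big_mkcond /index_iota subn1.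
Qed.

(** Relates the ceiling to the number of multiples of [c] in {1, ..., n-1}. *)
Lemma ceil_div_pred (n c : nat) : 0 < n -> 0 < c ->
  ceil_div n c = (n.-1 %/ c).+1.
Proof.
case: n c => // n [] // c _ _; rewrite /ceil_div /= addSnnS.
by rewrite divnDr // divnn addn1.
Qed.

Lemma ceil_div_antimono (n b c : nat) : 0 < b <= c ->
  ceil_div n c <= ceil_div n b.
Proof.
move=> /andP[b_gt0 lebc]; rewrite ceil_div_leq; last exact: leq_trans lebc.
apply: (@leq_trans (ceil_div n b * b)); first by rewrite -ceil_div_leq.
by rewrite leq_mul2l lebc orbT.
Qed.

Lemma Spec_intro (n k c : nat) :
  0 < c <= n -> c <= k.+1 -> k <= n - ceil_div n c -> Spec n k c.
Proof.
move=> /andP[c_gt0 lecn] leck lekn.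
(* All admissible distances, in increasing order, so that [take k s] keeps the smallest ones. *)
pose s := filter (predC (dvdn c)) (iota 1 n.-1).
have size_s : size s = n - ceil_div n c.
  rewrite ceil_div_pred ?(leq_trans c_gt0) //.
  have := count_predC (dvdn c) (iota 1 n.-1).
  by rewrite size_filter size_iota count_dvdn_iota //; lia.
have uniq_s : uniq s by rewrite filter_uniq // iota_uniq.
(* No number below [c] is filtered out, so [s] starts with 1, ..., c-1. *)
have sE : s = iota 1 c.-1 ++ filter (predC (dvdn c)) (iota c (n - c)).
  rewrite /s; have -> : n.-1 = c.-1 + (n - c) by lia.
  rewrite iotaD filter_cat add1n prednK //.
  congr (_ ++ _); apply/all_filterP/allP => d; rewrite mem_iota /= => hd.
  by rewrite gtnNdvd //; lia.
have sP d : d \in take k s -> (0 < d < n) && ~~ (c %| d).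
  by move/mem_take; rewrite mem_filter mem_iota /=; lia.
exists [fset d in take k s]%fset; split.
- by move=> d; rewrite in_fset => /sP; lia.
- by rewrite card_fseq undup_id ?take_uniq // size_takel // size_s.
- symmetry; apply: chi_eq; first by rewrite c_gt0.
  + move=> d hd; rewrite inE sE take_cat size_iota.
    (* Since c - 1 <= k, the cut falls after the whole initial block. *)
    have -> : (k < c.-1) = false by lia.
    by rewrite mem_cat mem_iota; apply/orP; left; lia.
  + by move=> d; rewrite inE => /sP/andP[].
Qed.

Theorem theorem2p3 (n k m : nat)
  (hn : 0 < n) (hk : 0 < k)
  (hk_lb : n %/ 2 < k) (hk_ub : k <= n - 1)
  (hm : 2 <= m <= n - 1)
  (hkm_lb : n - ceil_div n m < k)
  (hkm_ub : k <= n - ceil_div n (m + 1)) :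
  forall c : nat, m + 1 <= c <= k + 1 -> Spec n k c.
Proof.
(* The bound c <= n comes from c <= k + 1 and k <= n - 1. *)
move=> c /andP[lemc leck]; apply: Spec_intro; [lia|lia|].
apply: leq_trans hkm_ub _; apply: leq_sub2l.
by apply: ceil_div_antimono; lia.
Qed.
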